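(* Let $m\ge 2$ be an integer, let $G$ be a group with identity $e$, and let $R=\bigoplus_{g\in G}R_g$ be a $G$-graded ring that is graded $m$-nil clean (respectively, graded strongly $m$-nil clean). Then: (i) $R_e$ is an $m$-nil clean ring (respectively, a strongly $m$-nil clean ring). (ii) If the group $G$ is $(m-1)$-torsion free, then every element of $R_g$ with $g\ne e$ is nilpotent.
   Context: Rings are associative with identity. A ring $R$ is $G$-graded if $R=\bigoplus_{g\in G}R_g$ with additive subgroups $R_g$ satisfying $R_gR_h\subseteq R_{gh}$ for all $g,h\in G$; elements of $\bigcup_{g}R_g$ are called homogeneous. An element $f$ is $m$-potent if $f^m=f$. A homogeneous element $x$ is graded $m$-nil clean if $x=f+n$ with $f$ a homogeneous $m$-potent and $n$ a homogeneous nilpotent; it is graded strongly $m$-nil clean if in addition $fn=nf$ for such a decomposition. The graded ring $R$ is graded (strongly) $m$-nil clean if every homogeneous element is graded (strongly) $m$-nil clean. An (ungraded) ring is $m$-nil clean if every element is the sum of an $m$-potent and a nilpotent, and strongly $m$-nil clean if every element is the sum of an $m$-potent and a nilpotent that commute. A group $G$ is $k$-torsion free if for every $g\in G$, $g^k=e$ implies $g=e$. *)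

(* Defs.v *)
From HB Require Import structures.
From mathcomp Require Import all_boot all_order all_algebra.
From mathcomp Require Import boolp classical_sets.

Set Implicit Arguments.
Unset Strict Implicit.
Unset Printing Implicit Defensive.

Import GRing.Theory.

Local Open Scope ring_scope.

Definition m_potent (m : nat) (R : pzRingType) (f : R) : Prop := f ^+ m = f.

Definition nilpotent_elt (R : pzRingType) (x : R) : Prop :=
  exists k : nat, x ^+ k = 0.

Definition m_nil_clean (m : nat) (R : pzRingType) : Prop :=
  forall x : R, exists f n : R,
    [/\ m_potent m f, nilpotent_elt n & x = f + n].

Definition strongly_m_nil_clean (m : nat) (R : pzRingType) : Prop :=
  forall x : R, exists f n : R,
    [/\ m_potent m f, nilpotent_elt n, x = f + n & f * n = n * f].

Definition torsion_free (k : nat) (G : groupType) : Prop :=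
  forall g : G, (g ^+ k = 1)%g -> g = 1%g.

(* A G-grading of R, as an internal direct sum of additive subgroups: the
   components span R, and finitely many elements taken from pairwise distinct
   components sum to 0 only if they are all 0. *)
Record grading (G : groupType) (R : pzRingType) := Grading {
  component :> G -> set R;
  component0 : forall g, component g 0;
  componentB : forall g x y,
    component g x -> component g y -> component g (x - y);
  componentM : forall g h x y,
    component g x -> component h y -> component (g * h)%g (x * y);
  component_span : forall x : R, exists (s : seq G) (c : G -> R),
    [/\ uniq s, forall g, component g (c g) & x = \sum_(g <- s) c g];
  component_direct : forall (s : seq G) (c : G -> R),
    uniq s -> (forall g, component g (c g)) ->
    \sum_(g <- s) c g = 0 -> forall g, g \in s -> c g = 0
}.

Section Graded.
Variables (G : groupType) (R : pzRingType) (A : grading G R).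

Definition homogeneous (x : R) : Prop := exists g : G, A g x.

Definition graded_m_nil_clean_elt (m : nat) (x : R) : Prop :=
  exists f n : R,
    [/\ homogeneous f /\ m_potent m f,
        homogeneous n /\ nilpotent_elt n & x = f + n].

Definition graded_strongly_m_nil_clean_elt (m : nat) (x : R) : Prop :=
  exists f n : R,
    [/\ homogeneous f /\ m_potent m f,
        homogeneous n /\ nilpotent_elt n, x = f + n & f * n = n * f].

Definition graded_m_nil_clean (m : nat) : Prop :=
  forall x : R, homogeneous x -> graded_m_nil_clean_elt m x.

Definition graded_strongly_m_nil_clean (m : nat) : Prop :=
  forall x : R, homogeneous x -> graded_strongly_m_nil_clean_elt m x.

Lemma componentN g x : A g x -> A g (- x).
Proof.
by move=> Ax; rewrite -sub0r; apply: componentB => //; apply: component0.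
Qed.

Lemma componentD g x y : A g x -> A g y -> A g (x + y).
Proof. by move=> Ax /componentN Ay; rewrite -[y]opprK; apply: componentB. Qed.

Lemma component_one : A 1%g 1.
Proof.
have [s [c [us Ac sum1]]] := component_span A 1.
pose e := \sum_(g <- s | g == 1%g) c g.
have Ae : A 1%g e.
  rewrite /e; elim/big_ind: _ => [|x y|g /eqP ->]; last exact: Ac.
    exact: component0.
  exact: componentD.
have homogP h x : A h x -> x = x * e.
  move=> Ax; pose y := x - x * e.
  have Ay : A h y.
    by apply: componentB => //; rewrite -[h]mulg1; apply: componentM.
  have yE : y = \sum_(g <- s | g != 1%g) x * c g.
    rewrite -mulr_sumr /y -{1}[x]mulr1 sum1 (bigID (pred1 1%g)) /= -/e mulrDr.
    by rewrite addrC addKr.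
  pose d k := if k == h then - y else x * c (h^-1 * k)%g.
  pose t := h :: [seq (h * g)%g | g <- s & g != 1%g].
  apply/eqP; rewrite -subr_eq0 -/y -oppr_eq0; apply/eqP.
  have <- : d h = - y by rewrite /d eqxx.
  apply: (@component_direct _ _ A t d); last exact: mem_head.
  - rewrite /t /= map_inj_uniq ?filter_uniq ?andbT //; last exact: mulgI.
    apply/mapP => -[g]; rewrite mem_filter => /andP[g1 _] /eqP.
    by rewrite eq_sym -[X in _ == X]mulg1 (inj_eq (mulgI h)) (negPf g1).
  - move=> k; rewrite /d; case: eqP => [->|_]; first exact: componentN.
    by rewrite -{1}[k](mulVKg h); apply: componentM.
  - rewrite big_cons big_map big_filter {1}/d eqxx yE addrC; apply/eqP.
    rewrite subr_eq0; apply/eqP; apply: eq_bigr => g g1.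
    by rewrite /d -[X in _ == X]mulg1 (inj_eq (mulgI h)) (negPf g1) mulKg.
suff -> : 1 = e :> R by [].
rewrite -[e]mul1r {1 2}sum1 mulr_suml; apply: eq_bigr => g _.
exact: homogP (Ac g).
Qed.

Definition component1 : {pred R} := fun x => `[< A 1%g x >].

Lemma component1_subring : subring_closed component1.
Proof.
split=> [|x y|x y]; first by apply/asboolP; apply: component_one.
- by move=> /asboolP Ax /asboolP Ay; apply/asboolP; apply: componentB.
- move=> /asboolP Ax /asboolP Ay; apply/asboolP.
  by rewrite -[1%g]mulg1; apply: componentM.
Qed.

Definition identity_component : Type := {x : R | x \in component1}.

HB.instance Definition _ := SubChoice.on identity_component.
HB.instance Definition _ :=
  GRing.SubChoice_isSubPzRing.Build R component1 identity_component
    component1_subring.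

End Graded.

(* Main.v *)
Require Import Defs.
From HB Require Import structures.
From mathcomp Require Import all_boot all_order all_algebra.
From mathcomp Require Import boolp classical_sets.

Set Implicit Arguments.
Unset Strict Implicit.
Unset Printing Implicit Defensive.

Import GRing.Theory.

Local Open Scope ring_scope.

(** Let [x] be homogeneous of degree [g] and [x = f + n] with [f], [n]
homogeneous of unspecified degrees.  Comparing components in the direct sum,
either [f] and [n] both have degree [g], or [x = 0]
([homogeneous_summands]).  Since [0 = 0 + 0] is itself a clean decomposition,
a homogeneous element of degree [g] always decomposes inside its own component
([graded_m_nil_clean_degree] and [graded_strongly_m_nil_clean_degree]).

In degree [1] this says that the identity component is (strongly) [m]-nil
clean, because powers and products in that subring are those of [R].  In
degree [g <> 1], the [m]-potent [f] lies in the components of degrees [g] and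
[g ^+ m]; if the group is [(m - 1)]-torsion free, these are different, so that
[f = 0] and [x = n] is nilpotent ([m_potent_off_identity_eq0]). *)

Section Grading.
Variables (G : groupType) (R : pzRingType) (A : grading G R).

Lemma component_disjoint g h x : g <> h -> A g x -> A h x -> x = 0.
Proof.
move=> /eqP gh Agx Ahx.
pose c k := if k == g then x else if k == h then - x else 0.
have <- : c g = x by rewrite /c eqxx.
apply: (@component_direct _ _ A [:: g; h]); last exact: mem_head.
- by rewrite /= inE gh.
- move=> k; rewrite /c; case: eqP => [->//|_]; case: eqP => [->|_].
    exact: componentN.
  exact: component0.
- by rewrite !big_cons big_nil /c !eqxx eq_sym (negPf gh) addr0 subrr.
Qed.

(** If one summand has degree [g], so has the other one, by subtraction;
otherwise [x] is in the sum of the components of other degrees, which meets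
that of degree [g] in [0]. *)
Lemma homogeneous_summands g x f n :
  A g x -> homogeneous A f -> homogeneous A n -> x = f + n ->
  (A g f /\ A g n) \/ x = 0.
Proof.
move=> Ax [h Af] [k An] xE.
have [hg|/eqP hg] := eqVneq h g.
  left; rewrite hg in Af; split=> //.
  by have -> : n = x - f; [rewrite xE addrC addKr | apply: componentB].
have [kg|/eqP kg] := eqVneq k g.
  left; rewrite kg in An; split=> //.
  by have -> : f = x - n; [rewrite xE addrK | apply: componentB].
right; have [hk|hk] := eqVneq h k.
  apply: (component_disjoint hg _ Ax).
  by rewrite xE; apply: componentD => //; rewrite hk.
move/eqP in hg; move/eqP in kg.
(* The relation [- x + f + n = 0] now involves three distinct degrees. *)
pose c l := if l == g then - x else if l == h then f
            else if l == k then n else 0.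
apply: oppr_inj; rewrite oppr0; have <- : c g = - x by rewrite /c eqxx.
apply: (@component_direct _ _ A [:: g; h; k]); last exact: mem_head.
- by rewrite /= !inE negb_or hk ![g == _]eq_sym hg kg.
- move=> l; rewrite /c; case: eqP => [->|_]; first exact: componentN.
  case: eqP => [->//|_]; case: eqP => [->//|_]; exact: component0.
- rewrite !big_cons big_nil /c !eqxx (negPf hg) (negPf kg) eq_sym (negPf hk).
  by rewrite addr0 xE addNr.
Qed.

Lemma componentX g x i : A g x -> A (g ^+ i)%g (x ^+ i).
Proof.
move=> Ax; elim: i => [|i IHi]; first exact: component_one.
by rewrite exprS expgS; apply: componentM.
Qed.

Lemma m_potent0 m : (0 < m)%N -> m_potent m (0 : R).
Proof. by case: m => // m _; rewrite /m_potent exprS mul0r. Qed.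

Lemma nilpotent_elt0 : nilpotent_elt (0 : R).
Proof. by exists 1%N; rewrite expr1. Qed.

Lemma graded_m_nil_clean_degree m g x :
  (0 < m)%N -> graded_m_nil_clean A m -> A g x ->
  exists f n : R,
    [/\ A g f /\ m_potent m f, A g n /\ nilpotent_elt n & x = f + n].
Proof.
move=> m0 clA Ax; have [|f [n [[hf pf] [hn nn] xE]]] := clA x; first by exists g.
have [[Af An]|->] := homogeneous_summands Ax hf hn xE; first by exists f, n.
exists 0, 0; split; last by rewrite addr0.
- by split; [apply: component0 | apply: m_potent0].
- by split; [apply: component0 | apply: nilpotent_elt0].
Qed.

Lemma graded_strongly_m_nil_clean_degree m g x :
  (0 < m)%N -> graded_strongly_m_nil_clean A m -> A g x ->
  exists f n : R,
    [/\ A g f /\ m_potent m f, A g n /\ nilpotent_elt n, x = f + n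
      & f * n = n * f].
Proof.
move=> m0 clA Ax; have [|f [n [[hf pf] [hn nn] xE fn]]] := clA x.
  by exists g.
have [[Af An]|->] := homogeneous_summands Ax hf hn xE; first by exists f, n.
exists 0, 0; split=> //; last by rewrite addr0.
- by split; [apply: component0 | apply: m_potent0].
- by split; [apply: component0 | apply: nilpotent_elt0].
Qed.

Lemma graded_strongly_m_nil_clean_weaken m :
  graded_strongly_m_nil_clean A m -> graded_m_nil_clean A m.
Proof. by move=> clA x /clA[f [n [? ? ? _]]]; exists f, n. Qed.

Lemma identity_component_lift x :
  A 1%g x -> exists y : identity_component A, \val y = x.
Proof.
move=> Ax; have x1 : x \in component1 A by apply/asboolP.
by exists (Sub x x1); rewrite SubK.
Qed.

Lemma identity_component_val (y : identity_component A) : A 1%g (\val y).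
Proof. exact/asboolP/(valP y). Qed.

Lemma m_potent_val m (y : identity_component A) :
  m_potent m (\val y) -> m_potent m y.
Proof. by move=> py; apply: val_inj; rewrite rmorphXn. Qed.

Lemma nilpotent_elt_val (y : identity_component A) :
  nilpotent_elt (\val y) -> nilpotent_elt y.
Proof. by case=> i yi0; exists i; apply: val_inj; rewrite rmorphXn yi0 rmorph0. Qed.

Lemma identity_component_m_nil_clean m :
  (0 < m)%N -> graded_m_nil_clean A m -> m_nil_clean m (identity_component A).
Proof.
move=> m0 clA x; have Ax := identity_component_val x.
have [f [n [[Af pf] [An nn] xE]]] := graded_m_nil_clean_degree m0 clA Ax.
have [f' f'E] := identity_component_lift Af.
have [n' n'E] := identity_component_lift An; subst f n.
exists f', n'; split; [exact: m_potent_val | exact: nilpotent_elt_val |].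
by apply: val_inj; rewrite xE rmorphD.
Qed.

Lemma identity_component_strongly_m_nil_clean m :
  (0 < m)%N -> graded_strongly_m_nil_clean A m ->
  strongly_m_nil_clean m (identity_component A).
Proof.
move=> m0 clA x; have Ax := identity_component_val x.
have [f [n [[Af pf] [An nn] xE fn]]] :=
  graded_strongly_m_nil_clean_degree m0 clA Ax.
have [f' f'E] := identity_component_lift Af.
have [n' n'E] := identity_component_lift An; subst f n.
exists f', n'; split; [exact: m_potent_val | exact: nilpotent_elt_val | |].
- by apply: val_inj; rewrite xE rmorphD.
- by apply: val_inj; rewrite !rmorphM.
Qed.

(** As [f = f ^+ m] has degrees [g] and [g ^+ m], it can only be nonzero if
[g ^+ m = g], that is, if [g ^+ (m - 1) = 1]. *)
Lemma m_potent_off_identity_eq0 m g f :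
  (0 < m)%N -> torsion_free (m - 1)%N G -> g <> 1%g -> A g f ->
  m_potent m f -> f = 0.
Proof.
move=> m0 tfG g1 Af pf; apply: (@component_disjoint g (g ^+ m)%g) => //.
  move=> gm; apply: g1; apply: tfG; apply: (mulgI g).
  by rewrite -expgS subn1 prednK // mulg1.
by rewrite -pf; apply: componentX.
Qed.

Lemma nilpotent_off_identity m g x :
  (0 < m)%N -> graded_m_nil_clean A m -> torsion_free (m - 1)%N G ->
  g <> 1%g -> A g x -> nilpotent_elt x.
Proof.
move=> m0 clA tfG g1 Ax.
have [f [n [[Af pf] [_ nn] ->]]] := graded_m_nil_clean_degree m0 clA Ax.
by rewrite (m_potent_off_identity_eq0 m0 tfG g1 Af pf) add0r.
Qed.

End Grading.

Theorem proposition3p10 (m : nat) (hm : (2 <= m)%N) (G : groupType)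
    (R : pzRingType) (A : grading G R) :
  (graded_m_nil_clean A m ->
     m_nil_clean m (identity_component A) /\
     (torsion_free (m - 1)%N G ->
        forall (g : G) (x : R), g <> 1%g -> A g x -> nilpotent_elt x)) /\
  (graded_strongly_m_nil_clean A m ->
     strongly_m_nil_clean m (identity_component A) /\
     (torsion_free (m - 1)%N G ->
        forall (g : G) (x : R), g <> 1%g -> A g x -> nilpotent_elt x)).
Proof.
have m0 : (0 < m)%N := ltnW hm.
split=> clA; split.
- exact: identity_component_m_nil_clean.
- by move=> tfG g x; apply: nilpotent_off_identity tfG.
- exact: identity_component_strongly_m_nil_clean.
- move=> tfG g x; apply: nilpotent_off_identity tfG => //.
  exact: graded_strongly_m_nil_clean_weaken.
Qed.
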